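(* Let $\Lambda$ be a Noetherian semiperfect ring and let $n \geq 0$. The following are equivalent: (i) $\operatorname{dell} \Lambda \leq n$. (ii) $\Omega^n S$ is a stable retract of $\Omega^{n+1}\Sigma^{n+1}\Omega^n S$ for each simple module $S$. (iii) The unit map $\eta_{n+1} : \Omega^n S \to \Omega^{n+1}\Sigma^{n+1}\Omega^n S$ splits in $\underline{\mathsf{mod}}\,\Lambda$ for each simple module $S$.
   Context: Noetherian means two-sided Noetherian. $\mathsf{mod}\,\Lambda$ is the category of finitely presented right $\Lambda$-modules; simple modules are objects of $\mathsf{mod}\,\Lambda$. The stable category $\underline{\mathsf{mod}}\, \Lambda$ has the same objects, with morphisms taken modulo those factoring through projective objects; a stable retract is a retract in $\underline{\mathsf{mod}}\,\Lambda$. The syzygy functor $\Omega$ on $\underline{\mathsf{mod}}\,\Lambda$ is $\Omega M = \ker(P \twoheadrightarrow M)$ for any epimorphism from a projective $P$ in $\mathsf{mod}\,\Lambda$. The Auslander–Bridger transpose $\mathrm{Tr} : \underline{\mathsf{mod}}\,\Lambda \to \underline{\mathsf{mod}}\,\Lambda^{op}$ sends $M$ with presentation $P_1 \to P_0 \to M \to 0$ by finitely generated projectives to $\mathrm{coker}(P_0^* \to P_1^* )$, $(-)^* = \mathrm{Hom}(-,\Lambda)$; it is a contravariant duality. Put $\Sigma := \mathrm{Tr}\,\Omega\,\mathrm{Tr}$; by a result of Auslander–Reiten $\Sigma$ is left adjoint to $\Omega$ on $\underline{\mathsf{mod}}\,\Lambda$, so $\Sigma^n$ is left adjoint to $\Omega^n$,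 and $\eta_n : X \to \Omega^n\Sigma^n X$ denotes the unit. ''$\eta_n$ splits'' means that $\eta_n$ is a section (split monomorphism) in $\underline{\mathsf{mod}}\,\Lambda$. For $M \in \mathsf{mod}\,\Lambda$, $\operatorname{dell} M := \inf\{ n \geq 0 \mid \Omega^n M \text{ is a stable retract of } \Omega^{n+1} N \text{ for some } N \in \underline{\mathsf{mod}}\, \Lambda\}$ ($\infty$ if no such $n$), and $\operatorname{dell} \Lambda := \sup_S \operatorname{dell} S$ over simple $S$. *)

(* Defs.v *)
From Corelib Require Import Setoid Morphisms.
From HB Require Import structures.
From mathcomp Require Import all_boot all_algebra.
From mathcomp Require Import boolp classical_sets.

Set Implicit Arguments.
Unset Strict Implicit.
Unset Printing Implicit Defensive.

Import GRing.Theory.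
Local Open Scope classical_set_scope.
Local Open Scope ring_scope.

(* Equality of morphisms is a relation [heq] on the hom-types, so that morphisms
   of the stable category are represented by linear maps. *)
Record category := Category {
  ob :> Type;
  hom : ob -> ob -> Type;
  heq : forall a b, hom a b -> hom a b -> Prop;
  idm : forall a, hom a a;
  hcomp : forall a b c, hom b c -> hom a b -> hom a c;
  heq_equiv : forall a b, Equivalence (@heq a b);
  comp_proper : forall a b c, Proper (@heq b c ==> @heq a b ==> @heq a c) (@hcomp a b c);
  hcompA : forall a b c d (h : hom c d) (g : hom b c) (f : hom a b),
    heq (hcomp h (hcomp g f)) (hcomp (hcomp h g) f);
  hcomp1m : forall a b (f : hom a b), heq (hcomp (idm b) f) f;
  hcompm1 : forall a b (f : hom a b), heq (hcomp f (idm a)) f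
}.
Arguments idm {c0} a : rename.

Notation "g \\o f" := (hcomp g f) (at level 50, left associativity).
Notation "f ~= g" := (heq f g) (at level 70).

#[global] Existing Instance heq_equiv.
#[global] Existing Instance comp_proper.
Lemma heq_refl (C : category) (a b : C) (f : hom a b) : f ~= f.
Proof. by reflexivity. Qed.
#[global] Hint Resolve heq_refl : core.

Definition op_category (C : category) : category.
Proof.
refine (@Category C (fun a b => hom b a) (fun a b => @heq C b a) (@idm C)
  (fun a b c g f => f \\o g) (fun a b => heq_equiv b a) _ _ _ _).
- by move=> a b c g g' gg' f f' ff'; rewrite gg' ff'.
- by move=> a b c d h g f; rewrite hcompA.
- by move=> a b f; exact: hcompm1.
- by move=> a b f; exact: hcomp1m.
Defined.

Record functor (C D : category) := Functor {
  fob :> C -> D;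
  fmap : forall a b : C, hom a b -> hom (fob a) (fob b);
  fmap_proper : forall a b, Proper (@heq C a b ==> @heq D _ _) (@fmap a b);
  fmap_id : forall a, fmap (idm a) ~= idm (fob a);
  fmap_comp : forall a b c (g : hom b c) (f : hom a b),
    fmap (g \\o f) ~= fmap g \\o fmap f
}.
#[global] Existing Instance fmap_proper.

Record adjunction (C D : category) (F : functor C D) (G : functor D C) :=
  Adjunction {
  adj_unit : forall X : C, hom X (G (F X));
  adj_counit : forall Y : D, hom (F (G Y)) Y;
  unit_nat : forall X X' (f : hom X X'),
    fmap G (fmap F f) \\o adj_unit X ~= adj_unit X' \\o f;
  counit_nat : forall Y Y' (g : hom Y Y'),
    g \\o adj_counit Y ~= adj_counit Y' \\o fmap F (fmap G g);
  unit_counit : forall X, adj_counit (F X) \\o fmap F (adj_unit X) ~= idm (F X);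
  counit_unit : forall Y, fmap G (adj_counit Y) \\o adj_unit (G Y) ~= idm (G Y)
}.

Definition idF (C : category) : functor C C.
Proof.
refine (@Functor C C id (fun a b f => f) _ _ _); first by move=> ? ? ?.
- by move=> a; reflexivity.
- by move=> *; reflexivity.
Defined.

Definition compF (C D E : category) (G : functor D E) (F : functor C D) : functor C E.
Proof.
refine (@Functor C E (fun X => G (F X)) (fun a b f => fmap G (fmap F f)) _ _ _).
- by move=> a b f f' ff'; rewrite ff'.
- by move=> a; rewrite !fmap_id.
- by move=> a b c g f; rewrite !fmap_comp.
Defined.

Definition id_adj (C : category) : adjunction (idF C) (idF C).
Proof.
by refine (@Adjunction _ _ (idF C) (idF C) (@idm C) (@idm C) _ _ _ _);
  move=> * /=; rewrite ?hcompm1 ?hcomp1m.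
Defined.

Section CompAdj.
Variables (C D E : category) (F1 : functor C D) (G1 : functor D C).
Variables (F2 : functor D E) (G2 : functor E D).
Variables (a1 : adjunction F1 G1) (a2 : adjunction F2 G2).

Definition comp_adj : adjunction (compF F2 F1) (compF G1 G2).
Proof.
refine (@Adjunction _ _ (compF F2 F1) (compF G1 G2)
  (fun X => fmap G1 (adj_unit a2 (F1 X)) \\o adj_unit a1 X)
  (fun Y => adj_counit a2 Y \\o fmap F2 (adj_counit a1 (G2 Y))) _ _ _ _) => /=.
- move=> X X' f.
  rewrite hcompA -fmap_comp unit_nat fmap_comp -[X in X ~= _]hcompA unit_nat.
  by rewrite hcompA.
- move=> Y Y' g.
  rewrite hcompA counit_nat -[X in X ~= _]hcompA -fmap_comp counit_nat fmap_comp.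
  by rewrite hcompA.
- move=> X.
  rewrite -hcompA -(fmap_comp F2) (fmap_comp F1) (hcompA (adj_counit a1 _)).
  by rewrite -counit_nat -(hcompA (adj_unit a2 _)) unit_counit hcompm1 unit_counit.
- move=> Y.
  rewrite hcompA -(fmap_comp G1) (fmap_comp G2) -(hcompA (fmap G2 (adj_counit a2 _))).
  by rewrite unit_nat hcompA counit_unit hcomp1m counit_unit.
Defined.
End CompAdj.

(* Right modules over a ring L are represented by [lmodType L^c], with [L^c]
   the converse ring; a left L-module is an [lmodType L]. *)

Definition lin (A : pzRingType) (U V : lmodType A) (f : U -> V) (fl : linear f) :
  {linear U -> V} := HB.pack f (GRing.isLinear.Build A U V *:%R f fl).

Lemma lin_eq (A : pzRingType) (U V : lmodType A) (f g : {linear U -> V}) :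
  f =1 g -> f = g.
Proof.
move: f g => [f [[f1] [f2]]] [g [[g1] [g2]]] /= /funext fg.
move: f1 f2 g1 g2; rewrite fg => f1 f2 g1 g2.
by rewrite (Prop_irrelevance f1 g1) (Prop_irrelevance f2 g2).
Qed.

Section Definitions.
Variable A : pzRingType.
Implicit Types K M P U V W : lmodType A.

Definition surj U V (f : {linear U -> V}) := forall y, exists x, f x = y.

Definition exact_at U V W (f : {linear U -> V}) (g : {linear V -> W}) :=
  forall y, g y = 0 <-> exists x, f x = y.

Definition submodule M (N : set M) :=
  N 0 /\ forall a x y, N x -> N y -> N (a *: x + y).

Definition fg_submodule M (N : set M) :=
  exists n (g : {linear 'rV[A]_n -> M}), forall y, N y <-> exists x, g x = y.

Definition finitely_generated M :=
  exists n (g : {linear 'rV[A]_n -> M}), surj g.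

Definition finitely_presented M :=
  exists m n (f : {linear 'rV[A]_m -> 'rV[A]_n}) (g : {linear 'rV[A]_n -> M}),
    surj g /\ exact_at f g.

Definition projective P := forall U V (e : {linear U -> V}) (f : {linear P -> V}),
  surj e -> exists g : {linear P -> U}, forall x, e (g x) = f x.

Definition simple_module M := (exists x : M, x <> 0) /\
  forall N : set M, submodule N -> N `<=` [set 0] \/ N = setT.

Definition superfluous M (K : set M) := forall N : set M, submodule N ->
  (forall x, exists k y, [/\ K k, N y & x = k + y]) -> N = setT.

Definition has_projective_cover M :=
  exists (P : lmodType A) (p : {linear P -> M}),
    [/\ projective P, surj p & superfluous [set x | p x = 0]].

Definition left_noetherian := forall I : set A^o, submodule I -> fg_submodule I.

Record fpmod := FPMod {
  fp_sort :> lmodType A;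
  fpP : finitely_presented fp_sort
}.

End Definitions.

Definition noetherian (L : pzRingType) := left_noetherian L /\ left_noetherian L^c.

(* Bass: every finitely generated right module has a projective cover *)
Definition semiperfect (L : pzRingType) :=
  forall M : lmodType L^c, finitely_generated M -> has_projective_cover M.

Section Ker.
Variables (A : pzRingType) (U V : lmodType A) (f : {linear U -> V}).
Definition ker_mem : {pred U} := [pred x | f x == 0].
Lemma ker_closed : submod_closed ker_mem.
Proof.
split=> [|a x y]; rewrite !inE ?linear0 // => /eqP fx /eqP fy.
by rewrite linearP fx fy scaler0 addr0.
Qed.
HB.instance Definition _ := GRing.isSubmodClosed.Build A U ker_mem ker_closed.
Definition ker_mod := {x : U | ker_mem x}.
HB.instance Definition _ := SubType.on ker_mod.
HB.instance Definition _ := Choice.on ker_mod.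
HB.instance Definition _ := [SubChoice_isSubLmodule of ker_mod by <:].
Definition ker_in : {linear ker_mod -> U} := val.
End Ker.

Section Coker.
Variables (A : pzRingType) (U V : lmodType A) (f : {linear U -> V}).
Definition im_mem : {pred V} := [pred y | `[< exists x, f x = y >]].
Lemma im_memP y : reflect (exists x, f x = y) (y \in im_mem).
Proof. exact: asboolP. Qed.
Lemma im_closed : zmod_closed im_mem.
Proof.
split=> [|x y]; first by apply/im_memP; exists 0; rewrite linear0.
move=> /im_memP[u <-] /im_memP[v <-]; apply/im_memP.
by exists (u - v); rewrite linearB.
Qed.
HB.instance Definition _ := GRing.isZmodClosed.Build V im_mem im_closed.
Definition coker := Quotient.quot im_mem.
HB.instance Definition _ := GRing.Zmodule.on coker.
Definition cpi (x : V) : coker := (\pi_(Quotient.quot im_mem) x)%qT.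
Definition crepr (y : coker) : V := repr (y : Quotient.quot im_mem).
Lemma creprK y : cpi (crepr y) = y.
Proof. exact: (@reprK _ (Quotient.quot im_mem)). Qed.
Lemma cpiD x y : cpi (x + y) = cpi x + cpi y.
Proof. exact: (raddfD (\pi_(Quotient.quot im_mem))%qT). Qed.
Lemma cpi_eq (x y : V) : cpi x = cpi y <-> exists z, f z = x - y.
Proof.
split=> [/eqP|[z fz]]; last first.
  by apply/eqP; rewrite -(Quotient.idealrBE im_mem); apply/im_memP; exists z.
by rewrite -(Quotient.idealrBE im_mem) => /im_memP.
Qed.

Definition cscale (a : A) (x : coker) : coker := cpi (a *: crepr x).
Lemma cscaleE a x : cscale a (cpi x) = cpi (a *: x).
Proof.
apply/cpi_eq; have /cpi_eq[z fz] := creprK (cpi x).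
by exists (a *: z); rewrite linearZ_LR fz scalerBr.
Qed.

Lemma cscaleA a b v : cscale a (cscale b v) = cscale (a * b) v.
Proof. by rewrite -[v]creprK !cscaleE scalerA. Qed.
Lemma cscale1 : left_id 1 cscale.
Proof. by move=> v; rewrite -[v]creprK cscaleE scale1r. Qed.
Lemma cscaleDr : right_distributive cscale +%R.
Proof.
by move=> a u v; rewrite -[u]creprK -[v]creprK -cpiD !cscaleE scalerDr cpiD.
Qed.

Lemma cscaleDl v : {morph cscale^~ v : a b / a + b}.
Proof. by move=> a b; rewrite -[v]creprK !cscaleE scalerDl cpiD. Qed.
HB.instance Definition _ := GRing.Zmodule_isLmodule.Build A coker
  cscaleA cscale1 cscaleDr cscaleDl.
Lemma cpi_linear : linear cpi.
Proof. by move=> a x y; rewrite cpiD -cscaleE. Qed.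
Definition coker_pi : {linear V -> coker} := lin cpi_linear.
End Coker.

Section ModuleTheory.
Variable A : pzRingType.
Implicit Types K M P U V W : lmodType A.

Lemma exact0 U V W (f : {linear U -> V}) (g : {linear V -> W}) x :
  exact_at f g -> g (f x) = 0.
Proof. by move=> fg; apply/fg; exists x. Qed.

Lemma lin_factor U V W (e : {linear U -> V}) (g : {linear U -> W}) :
  surj e -> (forall x, e x = 0 -> g x = 0) ->
  exists j : {linear V -> W}, forall x, j (e x) = g x.
Proof.
move=> es eg; have [s sK] := choice es.
have ge x y : e x = e y -> g x = g y.
  by move=> exy; apply/eqP; rewrite -subr_eq0 -linearB eg ?linearB ?exy ?subrr.
have jl : linear (g \o s).
  by move=> a x y /=; rewrite -linearP; apply: ge; rewrite linearP !sK.
by exists (lin jl) => x /=; apply: ge; rewrite sK.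
Qed.

Lemma lin_lift K U V (i : {linear K -> V}) (g : {linear U -> V}) :
  injective i -> (forall x, exists y, i y = g x) ->
  exists h : {linear U -> K}, forall x, i (h x) = g x.
Proof.
move=> ii /choice[h hP].
have hl : linear h by move=> a x y; apply: ii; rewrite linearP !hP linearP.
by exists (lin hl).
Qed.

Definition rowmap_fun n M (m : 'I_n -> M) (v : 'rV[A]_n) : M :=
  \sum_i v 0 i *: m i.

Lemma rowmap_linear n M (m : 'I_n -> M) : linear (rowmap_fun m).
Proof.
move=> a u v; rewrite /rowmap_fun scaler_sumr -big_split; apply: eq_bigr => i _.
by rewrite !mxE scalerDl scalerA.
Qed.

Definition rowmap n M (m : 'I_n -> M) : {linear 'rV[A]_n -> M} :=
  lin (rowmap_linear m).

Lemma rowmapE n M (m : 'I_n -> M) v : rowmap m v = \sum_i v 0 i *: m i.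
Proof. by []. Qed.

Lemma row_expand n M (f : {linear 'rV[A]_n -> M}) v :
  f v = \sum_i v 0 i *: f (delta_mx 0 i).
Proof.
rewrite [v in LHS]row_sum_delta linear_sum; apply: eq_bigr => i _.
exact: linearZ_LR.
Qed.

Lemma free_projective n : projective 'rV[A]_n.
Proof.
move=> U V e f es.
have /choice[m mP] : forall i : 'I_n, exists u, e u = f (delta_mx 0 i).
  by move=> i; apply: es.
exists (rowmap m) => x; rewrite rowmapE linear_sum (row_expand f).
by apply: eq_bigr => i _; rewrite linearZ_LR mP.
Qed.

Definition pairmap_fun m n M (f : {linear 'rV[A]_m -> M})
  (g : {linear 'rV[A]_n -> M}) (v : 'rV[A]_(m + n)) : M :=
  f (lsubmx v) + g (rsubmx v).

Lemma pairmap_linear m n M (f : {linear 'rV[A]_m -> M})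
  (g : {linear 'rV[A]_n -> M}) : linear (pairmap_fun f g).
Proof. by move=> a u v; rewrite /pairmap_fun !linearP scalerDr addrACA. Qed.

Definition pairmap m n M (f : {linear 'rV[A]_m -> M})
  (g : {linear 'rV[A]_n -> M}) : {linear 'rV[A]_(m + n) -> M} :=
  lin (pairmap_linear f g).

Lemma pairmapE m n M (f : {linear 'rV[A]_m -> M}) (g : {linear 'rV[A]_n -> M}) u v :
  pairmap f g (row_mx u v) = f u + g v.
Proof. by rewrite /= /pairmap_fun row_mxKl row_mxKr. Qed.

Lemma submodule_sum M (N : set M) n (c : 'I_n -> A) (m : 'I_n -> M) :
  submodule N -> (forall i, N (m i)) -> N (\sum_i c i *: m i).
Proof.
move=> [N0 NP] Nm; apply: (big_ind N) => // [x y Nx Ny|i _].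
  by rewrite -[x]scale1r; apply: NP.
by rewrite -[_ *: _]addr0; apply: NP.
Qed.

Lemma submoduleB M (N : set M) x y : submodule N -> N x -> N y -> N (x - y).
Proof. by move=> [N0 NP] Nx Ny; rewrite addrC -scaleN1r; apply: NP. Qed.

Lemma submoduleD M (N : set M) x y : submodule N -> N x -> N y -> N (x + y).
Proof. by move=> [N0 NP] Nx Ny; rewrite -[x]scale1r; apply: NP. Qed.

Lemma ker_submodule U V (f : {linear U -> V}) : submodule [set x | f x = 0].
Proof.
by split=> [|a x y] /=; rewrite ?linear0 // linearP => -> ->; rewrite scaler0 addr0.
Qed.

Lemma fg_im M M' (f : {linear M -> M'}) (N : set M) :
  fg_submodule N -> fg_submodule [set f x | x in N].
Proof.
move=> [n [g gP]]; exists n, (f \o g) => y; split=> [[x /gP[u <-] <-]|[u <-]].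
  by exists u.
by exists (g u) => //; apply/gP; exists u.
Qed.

Lemma fg_ext M M' (f : {linear M -> M'}) (N : set M) : submodule N ->
  fg_submodule [set f x | x in N] -> fg_submodule [set x | N x /\ f x = 0] ->
  fg_submodule N.
Proof.
move=> sN [n [g gP]] [k [h hP]].
have /choice[m mP] : forall i : 'I_n, exists x, N x /\ f x = g (delta_mx 0 i).
  move=> i; have /gP[x Nx <-] : exists u, g u = g (delta_mx 0 i) by exists (delta_mx 0 i).
  by exists x.
have fm u : f (rowmap m u) = g u.
  rewrite rowmapE linear_sum (row_expand g); apply: eq_bigr => i _.
  by rewrite linearZ_LR (mP i).2.
have Nm u : N (rowmap m u) by apply: submodule_sum => // i; case: (mP i).
exists (n + k)%N, (pairmap (rowmap m) h) => y; split=> [Ny|[v <-]]; last first.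
  rewrite -[v]hsubmxK pairmapE; apply: submoduleD => //.
  by case: ((hP (h (rsubmx v))).2 _) => //; exists (rsubmx v).
have /gP[u gu] : [set f x | x in N] (f y) by exists y.
have /hP[w hw] : [set x | N x /\ f x = 0] (y - rowmap m u).
  by split; [apply: submoduleB|rewrite linearB fm gu subrr].
by exists (row_mx u w); rewrite pairmapE hw addrC subrK.
Qed.

Hypothesis noethA : left_noetherian A.

Lemma noeth_free n (N : set 'rV[A]_n) : submodule N -> fg_submodule N.
Proof.
elim: n N => [|n IHn] N sN.
  exists 0%N, idfun => y; split=> [Ny|_]; first by exists y.
  by rewrite [y]thinmx0; case: sN.
have fl : linear (fun v : 'rV[A]_(1 + n) => v 0 0 : A^o) by move=> a u v; rewrite !mxE.
have jl : linear (fun w : 'rV[A]_n => row_mx 0 w : 'rV[A]_(1 + n)).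
  by move=> a u v; rewrite scale_row_mx add_row_mx scaler0 addr0.
apply: (@fg_ext _ _ (lin fl) N sN).
  apply: noethA; split; first by exists 0; [case: sN|rewrite linear0].
  move=> a _ _ [x Nx <-] [y Ny <-]; exists (a *: x + y); last by rewrite linearP.
  exact: sN.2.
have sN' : submodule [set w | N (row_mx (0 : 'rV[A]_1) w)].
  split; first by rewrite /= row_mx0; case: sN.
  by move=> a x y /= Nx Ny; rewrite [row_mx _ _](jl a x y); apply: sN.2.
have [k [g gP]] := fg_im (lin jl) (IHn _ sN').
exists k, g => y; rewrite -gP; split=> [[Ny /= y0]|[w /= Nw <-]].
  have yE : y = row_mx (0 : 'rV[A]_1) (rsubmx (y : 'rV[A]_(1 + n))).
    rewrite -[LHS](@hsubmxK _ 1 1 n); congr row_mx; apply/rowP => i.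
    by rewrite !mxE ord1 -[RHS]y0; congr (y _ _); apply: val_inj.
  by exists (rsubmx (y : 'rV[A]_(1 + n))) => //=; rewrite -yE.
split=> //; rewrite /row_mx mxE; case: splitP => [j _|j /= //]; by rewrite mxE.
Qed.

Lemma noeth_fg M (N : set M) :
  finitely_generated M -> submodule N -> fg_submodule N.
Proof.
move=> [n [g gs]] [N0 NP].
have := @noeth_free n [set u | N (g u)] _.
case=> [|k [h hP]]; first by split=> [|a x y] /=; rewrite ?linear0 ?linearP //; apply: NP.
exists k, (g \o h) => y; split=> [Ny|[u <-]]; last by apply/hP; exists u.
have [x xy] := gs y; have Nx : N (g x) by rewrite xy.
by have /hP[u hu] := Nx; exists u; rewrite /= hu.
Qed.

Lemma noeth_fp M : finitely_generated M -> finitely_presented M.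
Proof.
move=> [n [g gs]]; have := @noeth_free n [set u | g u = 0] _.
case=> [|k [h hP]]; last by exists k, n, h, g.
by split=> [|a x y] /=; rewrite ?linear0 // linearP => -> ->; rewrite scaler0 addr0.
Qed.

Lemma ker_inP U V (f : {linear U -> V}) y : f y = 0 <-> exists x, ker_in f x = y.
Proof.
split=> [/eqP fy|[[x /eqP fx] <- //]].
by exists (exist _ y fy).
Qed.

Lemma ker_in_inj U V (f : {linear U -> V}) : injective (ker_in f).
Proof. exact: val_inj. Qed.

Lemma ker_fp U V (f : {linear U -> V}) :
  finitely_generated U -> finitely_presented (ker_mod f).
Proof.
move=> fgU; apply: noeth_fp.
have [|n [g gP]] := @noeth_fg U [set x | f x = 0] fgU.
  by split=> [|a x y] /=; rewrite ?linear0 // linearP => -> ->; rewrite scaler0 addr0.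
have [|h hP] := @lin_lift _ _ _ _ g (@ker_in_inj _ _ f).
  by move=> x; apply/ker_inP/gP; exists x.
exists n, h => y; have /gP[x xy] : f (ker_in f y) = 0 by apply/ker_inP; exists y.
by exists x; apply: ker_in_inj; rewrite hP.
Qed.

End ModuleTheory.

Section MoreModuleTheory.
Variable A : pzRingType.
Implicit Types K M P U V W : lmodType A.

Lemma fp_fg M : finitely_presented M -> finitely_generated M.
Proof. by move=> [_ [n [_ [g [gs _]]]]]; exists n, g. Qed.

Lemma coker_piP U V (f : {linear U -> V}) y :
  coker_pi f y = 0 <-> exists x, f x = y.
Proof.
have -> : (0 : coker f) = cpi f 0 by rewrite -[RHS]/(coker_pi f 0) linear0.
by rewrite -[coker_pi f y]/(cpi f y) cpi_eq subr0.
Qed.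

Lemma coker_pi_surj U V (f : {linear U -> V}) : surj (coker_pi f).
Proof. by move=> y; exists (crepr y); exact: creprK. Qed.

Lemma coker_fp U V (f : {linear U -> V}) : finitely_generated U ->
  finitely_presented V -> finitely_presented (coker f).
Proof.
move=> [k [u us]] [m [n [d [g [gs dg]]]]].
have [l lP] := free_projective (f \o u) gs.
exists (m + k)%N, n, (pairmap d l), (coker_pi f \o g); split.
  by move=> y; have [z <-] := coker_pi_surj y; have [x <-] := gs z; exists x.
move=> y; split=> [/coker_piP[x fx]|[v <-]].
  have [w wx] := us x; have : g (y - l w) = 0 by rewrite linearB lP /= wx fx subrr.
  by move=> /dg[z dz]; exists (row_mx z w); rewrite pairmapE dz subrK.
rewrite -[v]hsubmxK pairmapE; apply/coker_piP; exists (u (rsubmx v)).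
by rewrite linearD (exact0 _ dg) add0r lP.
Qed.

Definition free_retract P :=
  exists n (s : {linear P -> 'rV[A]_n}) (r : {linear 'rV[A]_n -> P}), cancel s r.

Lemma projective_retract P : finitely_generated P -> projective P -> free_retract P.
Proof.
move=> [n [r rs]] pP; have [s sP] := pP _ _ r idfun rs.
by exists n, s, r.
Qed.

Lemma retract_projective P : free_retract P -> projective P.
Proof.
move=> [n [s [r sK]]] U V e f es.
have [g gP] := free_projective (f \o r) es.
by exists (g \o s) => x; rewrite /= gP /= sK.
Qed.

Lemma retract_fp P : free_retract P -> finitely_presented P.
Proof.
move=> [n [s [r sK]]]; exists n, n, (idfun \- (s \o r)), r.
split=> [y|y]; first by exists (s y).
split=> [ry|[x <-]]; first by exists y; rewrite /= ry linear0 subr0.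
by rewrite linearB /= sK subrr.
Qed.

Lemma free_fp n : finitely_presented 'rV[A]_n.
Proof. by apply: retract_fp; exists n, idfun, idfun. Qed.

Lemma fpmod_cover (M : fpmod A) :
  exists (P : fpmod A) (p : {linear P -> M}), projective P /\ surj p.
Proof.
have [n [g gs]] := fp_fg (fpP M).
exists (FPMod (free_fp n)), g; split=> //; exact: free_projective.
Qed.

Lemma projective_lift_exact P U V W (f : {linear U -> V}) (g : {linear V -> W})
  (h : {linear P -> V}) : projective P -> exact_at f g -> (forall x, g (h x) = 0) ->
  exists k : {linear P -> U}, forall x, f (k x) = h x.
Proof.
move=> pP fg gh.
have [|f' f'P] := @lin_lift _ _ _ _ (ker_in g) f (@ker_in_inj _ _ _ g).
  by move=> x; apply/ker_inP/(exact0 _ fg).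
have [|h' h'P] := @lin_lift _ _ _ _ (ker_in g) h (@ker_in_inj _ _ _ g).
  by move=> x; apply/ker_inP/gh.
have f's : surj f'.
  move=> y; have /fg[x xy] : g (ker_in g y) = 0 by apply/ker_inP; exists y.
  by exists x; apply: ker_in_inj; rewrite f'P.
have [k kP] := pP _ _ f' h' f's.
by exists k => x; rewrite -f'P kP h'P.
Qed.

End MoreModuleTheory.

Section StableCategory.
Variable A : pzRingType.
Implicit Types M N Q : fpmod A.

Definition factors_projective M N (f : {linear M -> N}) :=
  exists P : fpmod A, projective P /\
    exists (h : {linear M -> P}) (k : {linear P -> N}), forall x, f x = k (h x).

Definition stable_eq M N (f g : {linear M -> N}) := factors_projective (f \- g).

Lemma factors_ext M N (f g : {linear M -> N}) :
  f =1 g -> factors_projective f -> factors_projective g.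
Proof.
by move=> fg [P [pP [h [k hk]]]]; exists P; split=> //; exists h, k => x; rewrite -fg.
Qed.

Lemma factors_cover M N (f : {linear M -> N}) (Q : lmodType A) (p : {linear Q -> N}) :
  surj p -> factors_projective f -> exists h : {linear M -> Q}, forall x, p (h x) = f x.
Proof.
move=> ps [P [pP [h [k hk]]]]; have [g gP] := pP _ _ p k ps.
by exists (g \o h) => x; rewrite /= gP hk.
Qed.

Lemma factorsD M N (f g : {linear M -> N}) :
  factors_projective f -> factors_projective g -> factors_projective (f \+ g).
Proof.
have [P [p [pP ps]]] := fpmod_cover N.
move=> /(factors_cover ps)[h hP] /(factors_cover ps)[k kP].
by exists P; split=> //; exists (h \+ k), p => x; rewrite linearD hP kP.
Qed.

Lemma factorsN M N (f : {linear M -> N}) :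
  factors_projective f -> factors_projective (\- f).
Proof.
move=> [P [pP [h [k hk]]]]; exists P; split=> //.
by exists (\- h), k => x; rewrite /= linearN hk.
Qed.

Lemma factors_compl M N Q (f : {linear M -> N}) (g : {linear N -> Q}) :
  factors_projective f -> factors_projective (g \o f).
Proof.
move=> [P [pP [h [k hk]]]]; exists P; split=> //.
by exists h, (g \o k) => x; rewrite /= hk.
Qed.

Lemma factors_compr M N Q (f : {linear M -> N}) (g : {linear N -> Q}) :
  factors_projective g -> factors_projective (g \o f).
Proof.
move=> [P [pP [h [k hk]]]]; exists P; split=> //.
by exists (h \o f), k => x; rewrite /= hk.
Qed.

Lemma stable_eq1 M N (f g : {linear M -> N}) : f =1 g -> stable_eq f g.
Proof.
move=> fg; have [P [p [pP ps]]] := fpmod_cover N.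
by exists P; split=> //; exists \0, p => x; rewrite /= fg subrr linear0.
Qed.

Lemma stable_equiv M N : Equivalence (@stable_eq M N).
Proof.
split=> [f|f g|f g h].
- exact: stable_eq1.
- by move=> /factorsN; apply: factors_ext => x /=; rewrite opprB.
- move=> fg gh; apply: factors_ext (factorsD fg gh) => x /=.
  by rewrite addrA subrK.
Qed.

Lemma stable_comp M N Q : Proper (@stable_eq N Q ==> @stable_eq M N ==> @stable_eq M Q)
  (fun g f => g \o f : {linear M -> Q}).
Proof.
move=> g g' gg' f f' ff'.
apply: factors_ext (factorsD (factors_compr f gg') (factors_compl g' ff')) => x /=.
by rewrite linearB addrA subrK.
Qed.

Definition stmod : category.
Proof.
refine (@Category (fpmod A) (fun M N => {linear M -> N}) stable_eq
  (fun M => idfun) (fun M N Q g f => g \o f : {linear M -> Q})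
  stable_equiv stable_comp _ _ _) => *; exact: stable_eq1.
Defined.

End StableCategory.

Section Syzygy.
Variable A : pzRingType.
Implicit Types M N Q : stmod A.

(* 0 -> K -> P -> M -> 0 *)
Record syzygy M := Syzygy {
  syz_K : fpmod A;
  syz_P : fpmod A;
  syz_i : {linear syz_K -> syz_P};
  syz_p : {linear syz_P -> M};
  syz_proj : projective syz_P;
  syz_inj : injective syz_i;
  syz_surj : surj syz_p;
  syz_exact : exact_at syz_i syz_p
}.

Arguments syz_proj {M} s.
Arguments syz_inj {M} s.
Arguments syz_surj {M} s.
Arguments syz_exact {M} s.

Definition syzygy_map M N (s : syzygy M) (t : syzygy N) (f : {linear M -> N})
    (g : {linear syz_K s -> syz_K t}) :=
  exists h : {linear syz_P s -> syz_P t},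
    (forall x, syz_p t (h x) = f (syz_p s x)) /\
    (forall x, h (syz_i s x) = syz_i t (g x)).

Arguments syzygy_map {M N} s t f g.

Lemma syzygy_map_ex M N (s : syzygy M) (t : syzygy N) (f : {linear M -> N}) :
  exists g, syzygy_map s t f g.
Proof.
have [h hP] := syz_proj s _ _ _ (f \o syz_p s) (syz_surj t).
have [|g gP] := @lin_lift _ _ _ _ (syz_i t) (h \o syz_i s) (syz_inj t).
  by move=> x; apply/(syz_exact t); rewrite /= hP /= (exact0 _ (syz_exact s)) linear0.
by exists g, h; split=> // x; rewrite gP.
Qed.

Lemma syzygy_map_eq M N (s : syzygy M) (t : syzygy N) (f f' : {linear M -> N}) g g' :
  stable_eq f f' -> syzygy_map s t f g -> syzygy_map s t f' g' -> stable_eq g g'.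
Proof.
move=> /(factors_cover (syz_surj t))[k kP] [h [hp hi]] [h' [hp' hi']].
have [|l lP] := @lin_lift _ _ _ _ (syz_i t) ((h \- h') \- (k \o syz_p s)) (syz_inj t).
  by move=> x; apply/(syz_exact t); rewrite /= !linearB kP /= hp hp' subrr.
exists (syz_P s); split; first exact: syz_proj.
exists (syz_i s), l => x; apply: (syz_inj t); rewrite lP /= linearB hi hi'.
by rewrite (exact0 _ (syz_exact s)) linear0 subr0.
Qed.

Lemma syzygy_map_id M (s : syzygy M) : syzygy_map s s idfun idfun.
Proof. by exists idfun. Qed.

Lemma syzygy_map_comp M N Q (s : syzygy M) (t : syzygy N) (u : syzygy Q)
  (f' : {linear N -> Q}) g' (f : {linear M -> N}) g :
  syzygy_map t u f' g' -> syzygy_map s t f g ->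
  syzygy_map s u (f' \o f) (g' \o g).
Proof.
move=> [h' [hp' hi']] [h [hp hi]]; exists (h' \o h); split=> x /=.
  by rewrite hp' hp.
by rewrite hi hi'.
Qed.

Hypothesis noethA : left_noetherian A.

Definition ker_syzygy M (P : fpmod A) (p : {linear P -> M}) (pP : projective P)
    (ps : surj p) : syzygy M :=
  @Syzygy M (FPMod (ker_fp noethA p (fp_fg (fpP P)))) P (ker_in p) p pP
    (@ker_in_inj _ _ _ p) ps (@ker_inP _ _ _ p).

Lemma syzygy_ex M : exists s : syzygy M, True.
Proof.
by have [P [p [pP ps]]] := fpmod_cover M; exists (ker_syzygy pP ps).
Qed.

(* An arbitrary choice of epimorphism from a projective: Omega M is only defined
   up to isomorphism in the stable category. *)
Definition a_syzygy M : syzygy M := projT1 (cid (syzygy_ex M)).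

Definition Omega_map M N (f : hom M N) :
    {linear syz_K (a_syzygy M) -> syz_K (a_syzygy N)} :=
  projT1 (cid (syzygy_map_ex (a_syzygy M) (a_syzygy N) f)).

Lemma Omega_mapP M N (f : hom M N) :
  syzygy_map (a_syzygy M) (a_syzygy N) f (Omega_map f).
Proof. exact: (projT2 (cid (syzygy_map_ex _ _ _))). Qed.

Definition Omega : functor (stmod A) (stmod A).
Proof.
refine (@Functor (stmod A) (stmod A) (fun M => syz_K (a_syzygy M)) Omega_map _ _ _).
- by move=> M N f f' ff'; apply: syzygy_map_eq ff' (Omega_mapP f) (Omega_mapP f').
- move=> M; apply: syzygy_map_eq (Omega_mapP _) (syzygy_map_id _).
  exact: stable_eq1.
- move=> M N Q g f.
  apply: syzygy_map_eq (Omega_mapP _) (syzygy_map_comp (Omega_mapP g) (Omega_mapP f)).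
  exact: stable_eq1.
Defined.

End Syzygy.

Arguments syz_proj {A M} s.
Arguments syz_inj {A M} s.
Arguments syz_surj {A M} s.
Arguments syz_exact {A M} s.
Arguments syzygy_map {A M N} s t f g.

(* [B] as an opposite ring of [A]; only the identity maps between [L] and [L^c]
   are used below, in both directions. *)
Record opposite (A B : pzRingType) := Opposite {
  to_op : A -> B;
  of_op : B -> A;
  to_opK : cancel to_op of_op;
  of_opK : cancel of_op to_op;
  to_opD : {morph to_op : x y / x + y};
  to_op1 : to_op 1 = 1;
  to_opM : forall x y, to_op (x * y) = to_op y * to_op x
}.

Section OppositeTheory.
Variables (A B : pzRingType) (t : opposite A B).

Lemma of_opD : {morph of_op t : x y / x + y}.
Proof. by move=> x y; rewrite -{1}[x](of_opK t) -{1}[y](of_opK t) -to_opD to_opK. Qed.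

Lemma of_op1 : of_op t 1 = 1.
Proof. by rewrite -(to_op1 t) to_opK. Qed.

Lemma of_opM x y : of_op t (x * y) = of_op t y * of_op t x.
Proof. by rewrite -{1}[x](of_opK t) -{1}[y](of_opK t) -to_opM to_opK. Qed.

Definition opposite_sym : opposite B A :=
  Opposite (of_opK t) (to_opK t) of_opD of_op1 of_opM.

Lemma to_op0 : to_op t 0 = 0.
Proof. by apply: (addrI (to_op t 0)); rewrite -to_opD !addr0. Qed.

Lemma to_op_sum I r (P : pred I) (F : I -> A) :
  to_op t (\sum_(i <- r | P i) F i) = \sum_(i <- r | P i) to_op t (F i).
Proof. by apply: (big_morph _ (to_opD t)); exact: to_op0. Qed.

End OppositeTheory.

(* [dual t M] is Hom(M, A), a module over the opposite ring by right
   multiplication on the values. *)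
Definition dual (A B : pzRingType) (t : opposite A B) (M : lmodType A) : Type :=
  {linear M -> A^o}.

Section Dual.
Variables (A B : pzRingType) (t : opposite A B) (M : lmodType A).
Local Notation D := (dual t M).

HB.instance Definition _ := gen_eqMixin D.
HB.instance Definition _ := gen_choiceMixin D.

Definition dual_zero : D := \0.
Definition dual_opp (f : D) : D := \- f.
Definition dual_add (f g : D) : D := f \+ g.

Lemma dual_addA : associative dual_add.
Proof. by move=> f g h; apply: lin_eq => x /=; rewrite addrA. Qed.
Lemma dual_addC : commutative dual_add.
Proof. by move=> f g; apply: lin_eq => x /=; rewrite addrC. Qed.
Lemma dual_add0 : left_id dual_zero dual_add.
Proof. by move=> f; apply: lin_eq => x /=; rewrite add0r. Qed.
Lemma dual_addN : left_inverse dual_zero dual_opp dual_add.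
Proof. by move=> f; apply: lin_eq => x /=; rewrite addNr. Qed.

HB.instance Definition _ :=
  GRing.isZmodule.Build D dual_addA dual_addC dual_add0 dual_addN.

Definition dual_scale_fun (b : B) (f : D) (x : M) : A^o := (f x : A) * of_op t b.

Lemma dual_scale_linear b f : linear (dual_scale_fun b f).
Proof.
move=> a x y; rewrite /dual_scale_fun linearP mulrDl; congr (_ + _).
by apply/esym; exact: mulrA.
Qed.

Definition dual_scale (b : B) (f : D) : D := lin (dual_scale_linear b f).

Lemma dual_scaleA a b f : dual_scale a (dual_scale b f) = dual_scale (a * b) f.
Proof.
by apply: lin_eq => x /=; rewrite /dual_scale_fun /= /dual_scale_fun of_opM mulrA.
Qed.

Lemma dual_scale1 : left_id 1 dual_scale.
Proof.
by move=> f; apply: lin_eq => x /=; rewrite /dual_scale_fun of_op1 mulr1.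
Qed.

Lemma dual_scaleDr : right_distributive dual_scale +%R.
Proof.
by move=> a f g; apply: lin_eq => x /=; rewrite /dual_scale_fun /= mulrDl.
Qed.

Lemma dual_scaleDl f : {morph dual_scale^~ f : a b / a + b}.
Proof.
by move=> a b; apply: lin_eq => x /=; rewrite /dual_scale_fun of_opD mulrDr.
Qed.

HB.instance Definition _ := GRing.Zmodule_isLmodule.Build B D
  dual_scaleA dual_scale1 dual_scaleDr dual_scaleDl.

Lemma dualDE (f g : D) x : (f + g) x = f x + g x. Proof. by []. Qed.
Lemma dualZE b (f : D) x : (b *: f) x = (f x : A) * of_op t b. Proof. by []. Qed.
Lemma dual_sumE I r (P : pred I) (F : I -> D) x :
  (\sum_(i <- r | P i) F i) x = \sum_(i <- r | P i) F i x.
Proof. by apply: (big_morph (fun f : D => f x)). Qed.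

End Dual.

Section DualMap.
Variables (A B : pzRingType) (t : opposite A B) (M N : lmodType A).
Variable f : {linear M -> N}.

Definition dual_map_fun (g : dual t N) : dual t M := (g : {linear N -> A^o}) \o f.

Lemma dual_map_linear : linear dual_map_fun.
Proof. by move=> b g h; apply: lin_eq. Qed.

Definition dual_map : {linear dual t N -> dual t M} := lin dual_map_linear.

Lemma dual_mapE g x : dual_map g x = g (f x). Proof. by []. Qed.

End DualMap.

Section DualTheory.
Variables (A B : pzRingType) (t : opposite A B).
Implicit Types M N P : lmodType A.

Lemma dual_eq M (f g : dual t M) : (forall x, f x = g x) -> f = g.
Proof. exact: lin_eq. Qed.

Lemma dual_retract P : free_retract P -> free_retract (dual t P).
Proof.
move=> [n [s [r sK]]].
pose s' (f : dual t P) : 'rV[B]_n := \row_i to_op t (f (r (delta_mx 0 i))).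
have sl : linear s'.
  move=> b f g; apply/rowP => i; rewrite !mxE dualDE dualZE to_opD to_opM.
  by rewrite of_opK.
pose c i (x : P) : A^o := s x 0 i.
have cl i : linear (c i) by move=> a x y; rewrite /c linearP !mxE.
pose r' : {linear 'rV[B]_n -> dual t P} := rowmap (fun i => lin (cl i) : dual t P).
exists n, (lin sl), r' => f; apply: dual_eq => x.
rewrite rowmapE dual_sumE -[x in RHS]sK (row_expand r (s x)) linear_sum.
apply: eq_bigr => i _; rewrite dualZE /= linearZ_LR mxE to_opK.
by [].
Qed.

Lemma dual_reflexive P (F : {linear dual t P -> B^o}) : free_retract P ->
  exists x, forall f, F f = to_op t (f x).
Proof.
move=> [n [s [r sK]]].
pose c i (x : P) : A^o := s x 0 i.
have cl i : linear (c i) by move=> a x y; rewrite /c linearP !mxE.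
pose d i : dual t P := lin (cl i).
pose e i := r (delta_mx 0 i).
exists (\sum_i of_op t (F (d i)) *: e i) => f.
have fE : f = \sum_i to_op t (f (e i)) *: d i.
  apply: dual_eq => x; rewrite dual_sumE -[x in LHS]sK (row_expand r (s x)) linear_sum.
  by apply: eq_bigr => i _; rewrite dualZE to_opK linearZ_LR.
rewrite [in LHS]fE !linear_sum to_op_sum; apply: eq_bigr => i _.
by rewrite !linearZ_LR to_opM of_opK.
Qed.

End DualTheory.

Section Transpose.
Variables (A B : pzRingType) (t : opposite A B).
Implicit Types M N Q : stmod A.

(* P1 -> P0 -> M -> 0 and Hom(P0, A) -> Hom(P1, A) -> T -> 0 *)
Record transpose M := Transpose {
  tr_P1 : fpmod A;
  tr_P0 : fpmod A;
  tr_T : fpmod B;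
  tr_d : {linear tr_P1 -> tr_P0};
  tr_e : {linear tr_P0 -> M};
  tr_q : {linear dual t tr_P1 -> tr_T};
  tr_proj1 : projective tr_P1;
  tr_proj0 : projective tr_P0;
  tr_e_surj : surj tr_e;
  tr_e_exact : exact_at tr_d tr_e;
  tr_q_surj : surj tr_q;
  tr_q_exact : exact_at (dual_map t tr_d) tr_q
}.
Arguments tr_proj1 {M} _.
Arguments tr_proj0 {M} _.
Arguments tr_e_surj {M} _.
Arguments tr_e_exact {M} _.
Arguments tr_q_surj {M} _.
Arguments tr_q_exact {M} _.

Definition transpose_map M N (s : transpose M) (u : transpose N)
    (f : {linear M -> N}) (g : {linear tr_T u -> tr_T s}) :=
  exists (f0 : {linear tr_P0 s -> tr_P0 u}) (f1 : {linear tr_P1 s -> tr_P1 u}),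
    [/\ forall x, tr_e u (f0 x) = f (tr_e s x),
        forall x, tr_d u (f1 x) = f0 (tr_d s x)
      & forall h, g (tr_q u h) = tr_q s (dual_map t f1 h)].
Arguments transpose_map {M N} s u f g.

Lemma dual_fp (P : fpmod A) : projective P -> finitely_presented (dual t P).
Proof.
by move=> pP; apply: retract_fp; apply: dual_retract; apply: projective_retract => //;
  apply: fp_fg; apply: fpP.
Qed.

Lemma dual_projective (P : fpmod A) : projective P -> projective (dual t P).
Proof.
by move=> pP; apply: retract_projective; apply: dual_retract;
  apply: projective_retract => //; apply: fp_fg; apply: fpP.
Qed.

Lemma transpose_map_ex M N (s : transpose M) (u : transpose N) (f : {linear M -> N}) :
  exists g, transpose_map s u f g.
Proof.
have [f0 f0P] := tr_proj0 s _ _ _ (f \o tr_e s) (tr_e_surj u).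
have [|f1 f1P] := projective_lift_exact (h := f0 \o tr_d s) (tr_proj1 s) (tr_e_exact u).
  by move=> x; rewrite /= f0P /= (exact0 _ (tr_e_exact s)) linear0.
have [|g gP] := lin_factor (g := tr_q s \o dual_map t f1) (tr_q_surj u).
  move=> h /(tr_q_exact u)[k <-] /=; apply/(tr_q_exact s).
  by exists (dual_map t f0 k); apply: dual_eq => x; rewrite !dual_mapE f1P.
by exists g, f0, f1; split=> // h; rewrite gP.
Qed.

Lemma transpose_map_eq M N (s : transpose M) (u : transpose N)
    (f f' : {linear M -> N}) g g' : stable_eq f f' ->
  transpose_map s u f g -> transpose_map s u f' g' -> stable_eq g g'.
Proof.
move=> /(factors_cover (tr_e_surj u))[k kP] [f0 [f1 [f0P f1P gP]]].
move=> [f0' [f1' [f0P' f1P' gP']]].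
have [|l lP] := projective_lift_exact (h := (f0 \- f0') \- (k \o tr_e s))
    (tr_proj0 s) (tr_e_exact u).
  by move=> x; rewrite /= !linearB f0P f0P' kP /= subrr.
pose c : {linear tr_P1 s -> tr_P1 u} := (f1 \- f1') \- (l \o tr_d s).
have dc x : tr_d u (c x) = 0.
  rewrite /= !linearB f1P f1P' lP /= (exact0 _ (tr_e_exact s)) linear0 subr0.
  by rewrite subrr.
have [|w wP] := lin_factor (g := dual_map t c) (tr_q_surj u).
  move=> h /(tr_q_exact u)[v <-]; apply: dual_eq => x.
  by rewrite !dual_mapE dc linear0.
exists (FPMod (dual_fp (tr_proj1 s))); split; first exact: dual_projective (tr_proj1 s).
exists w, (tr_q s) => y; have [h <-] := tr_q_surj u y.
rewrite wP /= gP gP' -linearB; apply/eqP; rewrite -subr_eq0 -linearB; apply/eqP.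
apply/(tr_q_exact s); exists (dual_map t l h); apply: dual_eq => x.
rewrite dual_mapE [RHS]/(_ - _) /= -/(tr_P1 s).
rewrite -[RHS]/(h (f1 x) - h (f1' x) - h (c x)) -!linearB /=.
by congr (h _); rewrite opprB addrC subrK.
Qed.

Lemma transpose_map_id M (s : transpose M) : transpose_map s s idfun idfun.
Proof.
by exists idfun, idfun; split=> // h; congr (tr_q s _); apply: dual_eq.
Qed.

Lemma transpose_map_comp M N Q (s : transpose M) (u : transpose N) (v : transpose Q)
  (f' : {linear N -> Q}) g' (f : {linear M -> N}) g :
  transpose_map u v f' g' -> transpose_map s u f g ->
  transpose_map s v (f' \o f) (g \o g').
Proof.
move=> [f0' [f1' [f0P' f1P' gP']]] [f0 [f1 [f0P f1P gP]]].
exists (f0' \o f0), (f1' \o f1); split=> [x|x|h] /=.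
- by rewrite f0P' f0P.
- by rewrite f1P' f1P.
- by rewrite gP' gP; congr (tr_q s _); apply: dual_eq.
Qed.

Definition coker_transpose M (P1 P0 : fpmod A) (d : {linear P1 -> P0})
    (e : {linear P0 -> M}) (p1 : projective P1) (p0 : projective P0)
    (es : surj e) (de : exact_at d e) : transpose M :=
  @Transpose M P1 P0
    (FPMod (coker_fp (dual_map t d) (fp_fg (dual_fp p0)) (dual_fp p1)))
    d e (coker_pi (dual_map t d)) p1 p0 es de
    (@coker_pi_surj _ _ _ (dual_map t d)) (@coker_piP _ _ _ (dual_map t d)).

Lemma transpose_ex M : exists s : transpose M, True.
Proof.
have [m [n [d [e [es de]]]]] := fpP M.
pose P1 := FPMod (free_fp A m); pose P0 := FPMod (free_fp A n).
by exists (@coker_transpose M P1 P0 d e (@free_projective A m) (@free_projective A n) es de).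
Qed.

(* An arbitrary choice of presentation, as for [a_syzygy]. *)
Definition a_transpose M : transpose M := projT1 (cid (transpose_ex M)).

Definition Tr_map M N (f : hom M N) :
    {linear tr_T (a_transpose N) -> tr_T (a_transpose M)} :=
  projT1 (cid (transpose_map_ex (a_transpose M) (a_transpose N) f)).

Lemma Tr_mapP M N (f : hom M N) :
  transpose_map (a_transpose M) (a_transpose N) f (Tr_map f).
Proof. exact: (projT2 (cid (transpose_map_ex _ _ _))). Qed.

Definition Tr : functor (op_category (stmod A)) (stmod B).
Proof.
refine (@Functor (op_category (stmod A)) (stmod B) (fun M => tr_T (a_transpose M))
  (fun M N f => Tr_map f) _ _ _).
- by move=> M N f f' ff'; apply: transpose_map_eq ff' (Tr_mapP f) (Tr_mapP f').
- move=> M; apply: transpose_map_eq (Tr_mapP _) (transpose_map_id _).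
  exact: stable_eq1.
- move=> M N Q g f.
  apply: transpose_map_eq (Tr_mapP _) (transpose_map_comp (Tr_mapP f) (Tr_mapP g)).
  exact: stable_eq1.
Defined.

End Transpose.

Arguments tr_proj1 {A B t M} t0 : rename.
Arguments tr_proj0 {A B t M} t0 : rename.
Arguments tr_e_surj {A B t M} t0 : rename.
Arguments tr_e_exact {A B t M} t0 : rename.
Arguments tr_q_surj {A B t M} t0 : rename.
Arguments tr_q_exact {A B t M} t0 : rename.
Arguments transpose_map {A B t M N} s u f g.
Arguments dual_projective {A B} t {P} _.

Section Sigma.
Variables (A B : pzRingType) (t : opposite A B) (noethB : left_noetherian B).

Definition Sigma : functor (stmod A) (stmod A).
Proof.
refine (@Functor (stmod A) (stmod A)
  (fun X => Tr (opposite_sym t) (Omega noethB (Tr t X)))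
  (fun X Y f => fmap (Tr (opposite_sym t)) (a := Omega noethB (Tr t X))
     (b := Omega noethB (Tr t Y))
     (fmap (Omega noethB) (fmap (Tr t) (a := Y) (b := X) f))) _ _ _).
- move=> X Y f f' ff'; apply: (fmap_proper (Tr (opposite_sym t))).
  apply: (fmap_proper (Omega noethB)); exact: (fmap_proper (Tr t)).
- move=> X; rewrite -(fmap_id (Tr (opposite_sym t))).
  apply: (fmap_proper (Tr (opposite_sym t))).
  rewrite -(fmap_id (Omega noethB)); apply: (fmap_proper (Omega noethB)).
  exact: (fmap_id (Tr t)).
- move=> X Y Z g f; rewrite -(fmap_comp (Tr (opposite_sym t))).
  apply: (fmap_proper (Tr (opposite_sym t))).
  apply: (Equivalence_Transitive _ _ _ _ (fmap_comp (Omega noethB) _ _)).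
  apply: (fmap_proper (Omega noethB)); exact: (fmap_comp (Tr t)).
Defined.

End Sigma.

Section Cosyzygy.
Variable A : pzRingType.
Implicit Types X Y Z : stmod A.

(* X -> L -> C -> 0 with X -> L a left approximation by projectives. Such a C is
   a representative of Tr Omega Tr X; this is how the adjunction between Sigma
   and Omega is obtained. *)
Record cosyzygy X := Cosyzygy {
  cs_L : fpmod A;
  cs_C : fpmod A;
  cs_j : {linear X -> cs_L};
  cs_c : {linear cs_L -> cs_C};
  cs_proj : projective cs_L;
  cs_surj : surj cs_c;
  cs_exact : exact_at cs_j cs_c;
  cs_approx : forall (P : fpmod A) (g : {linear X -> P}), projective P ->
    exists h : {linear cs_L -> P}, forall x, h (cs_j x) = g x
}.
Arguments cs_proj {X} _.
Arguments cs_surj {X} _.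
Arguments cs_exact {X} _.
Arguments cs_approx {X} _ {P} g.

Definition cosyzygy_map X X' (s : cosyzygy X) (s' : cosyzygy X') (f : {linear X -> X'})
    (r : {linear cs_C s -> cs_C s'}) :=
  exists l : {linear cs_L s -> cs_L s'},
    (forall x, l (cs_j s x) = cs_j s' (f x)) /\
    (forall y, r (cs_c s y) = cs_c s' (l y)).

Definition adjoint_map X Y (s : cosyzygy X) (u : syzygy Y)
    (g : {linear cs_C s -> Y}) (v : {linear X -> syz_K u}) :=
  exists m : {linear cs_L s -> syz_P u},
    (forall y, syz_p u (m y) = g (cs_c s y)) /\
    (forall x, syz_i u (v x) = m (cs_j s x)).
Arguments adjoint_map {X Y} s u g v.

Lemma adjoint_map_exr X Y (s : cosyzygy X) (u : syzygy Y) g :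
  exists v, adjoint_map s u g v.
Proof.
have [m mP] := cs_proj s _ _ _ (g \o cs_c s) (syz_surj u).
have [|v vP] := @lin_lift _ _ _ _ (syz_i u) (m \o cs_j s) (syz_inj u).
  by move=> x; apply/(syz_exact u); rewrite /= mP /= (exact0 _ (cs_exact s)) linear0.
by exists v, m.
Qed.

Lemma adjoint_map_exl X Y (s : cosyzygy X) (u : syzygy Y) v :
  exists g, adjoint_map s u g v.
Proof.
have [m mP] := cs_approx s (syz_i u \o v) (syz_proj u).
have [|g gP] := lin_factor (g := syz_p u \o m) (cs_surj s).
  by move=> y /(cs_exact s)[x <-] /=; rewrite mP /= (exact0 _ (syz_exact u)).
by exists g, m; split=> x; [rewrite gP|rewrite mP].
Qed.

Lemma adjoint_map_eqr X Y (s : cosyzygy X) (u : syzygy Y) g g' v v' :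
  stable_eq g g' -> adjoint_map s u g v -> adjoint_map s u g' v' -> stable_eq v v'.
Proof.
move=> /(factors_cover (syz_surj u))[k kP] [m [mp mi]] [m' [mp' mi']].
have [|l lP] := @lin_lift _ _ _ _ (syz_i u) ((m \- m') \- (k \o cs_c s)) (syz_inj u).
  by move=> x; apply/(syz_exact u); rewrite /= !linearB kP /= mp mp' subrr.
exists (cs_L s); split; first exact: cs_proj.
exists (cs_j s), l => x; apply: (syz_inj u); rewrite lP /= linearB mi mi'.
by rewrite (exact0 _ (cs_exact s)) linear0 subr0.
Qed.

Lemma adjoint_map_eql X Y (s : cosyzygy X) (u : syzygy Y) g g' v v' :
  stable_eq v v' -> adjoint_map s u g v -> adjoint_map s u g' v' -> stable_eq g g'.
Proof.
move=> [P [pP [h [k hk]]]] [m [mp mi]] [m' [mp' mi']].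
have [h' h'P] := cs_approx s h pP.
pose l : {linear cs_L s -> syz_K u} := k \o h'.
have [|w wP] := lin_factor (g := (m \- m') \- (syz_i u \o l)) (cs_surj s).
  move=> y /(cs_exact s)[x <-] /=; rewrite -mi -mi' -!linearB h'P -hk /=.
  by rewrite subrr linear0.
exists (syz_P u); split; first exact: syz_proj.
exists w, (syz_p u) => y; have [x <-] := cs_surj s y; rewrite wP /= !linearB mp mp'.
by rewrite (exact0 _ (syz_exact u)) subr0.
Qed.

Lemma adjoint_map_compl X Y Y' (s : cosyzygy X) (u : syzygy Y) (u' : syzygy Y')
    g v (h : {linear Y -> Y'}) k :
  adjoint_map s u g v -> syzygy_map u u' h k -> adjoint_map s u' (h \o g) (k \o v).
Proof.
move=> [m [mp mi]] [w [wp wi]]; exists (w \o m); split=> x /=.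
  by rewrite wp mp.
by rewrite -wi mi.
Qed.

Lemma adjoint_map_compr X X' Y (s : cosyzygy X) (s' : cosyzygy X') (u : syzygy Y)
    g v (f : {linear X -> X'}) r :
  adjoint_map s' u g v -> cosyzygy_map f r -> adjoint_map s u (g \o r) (v \o f).
Proof.
move=> [m [mp mi]] [l [lj lc]]; exists (m \o l); split=> x /=.
  by rewrite mp lc.
by rewrite mi lj.
Qed.

End Cosyzygy.

Arguments cs_proj {A X} c : rename.
Arguments cs_surj {A X} c : rename.
Arguments cs_exact {A X} c : rename.
Arguments adjoint_map {A X Y} s u g v.

Section Evaluation.
Variables (A B : pzRingType) (t : opposite A B) (M : lmodType A).

Lemma eval_linear x : linear (fun f : dual t M => to_op t (f x) : B^o).
Proof.
by move=> b f g; rewrite dualDE dualZE to_opD to_opM of_opK.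
Qed.

Definition eval_fun x : dual (opposite_sym t) (dual t M) := lin (eval_linear x).

Lemma eval_fun_linear : linear eval_fun.
Proof.
move=> a x y; apply: dual_eq => f; rewrite dualDE dualZE /= linearP to_opD.
congr (_ + _); exact: (to_opM t a (f x)).
Qed.

Definition eval : {linear M -> dual (opposite_sym t) (dual t M)} := lin eval_fun_linear.

Lemma evalE x f : eval x f = to_op t (f x). Proof. by []. Qed.

End Evaluation.

Section SigmaCosyzygy.
Variables (A B : pzRingType) (t : opposite A B) (noethB : left_noetherian B).
Local Notation t' := (opposite_sym t).
Implicit Types X Y : stmod A.
Local Notation tr := (a_transpose t).
Local Notation dualP1 X := (FPMod (dual_fp t (tr_proj1 (tr X)))).
Local Notation dualP0 X := (FPMod (dual_fp t (tr_proj0 (tr X)))).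

Definition trsyz X : syzygy (tr_T (tr X) : stmod B) :=
  @ker_syzygy B noethB (tr_T (tr X)) (dualP1 X) (tr_q (tr X))
    (dual_projective t (tr_proj1 (tr X))) (tr_q_surj (tr X)).

(* A presentation Q -> Hom(P0, A) -> K -> 0 of the syzygy K of Tr X given by
   Hom(P1, A) -> Tr X, for the chosen presentation P1 -> P0 -> X. *)
Record trdata X := TrData {
  td_Q : fpmod B;
  td_d : {linear td_Q -> dualP0 X};
  td_e : {linear dualP0 X -> syz_K (trsyz X)};
  td_proj : projective td_Q;
  td_surj : surj td_e;
  td_exact : exact_at td_d td_e;
  td_eE : forall f, syz_i (trsyz X) (td_e f) = dual_map t (tr_d (tr X)) f
}.
Arguments td_proj {X} _.
Arguments td_surj {X} _.
Arguments td_exact {X} _.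

Lemma trdata_ex X : exists D : trdata X, True.
Proof.
have [|e eP] := @lin_lift _ _ _ _ (syz_i (trsyz X)) (dual_map t (tr_d (tr X)))
    (syz_inj (trsyz X)).
  by move=> f; apply/(syz_exact (trsyz X)); apply/(tr_q_exact (tr X)); exists f.
have [n [d dP]] := noeth_fg noethB (N := [set f | e f = 0])
   (fp_fg (fpP (dualP0 X))) (ker_submodule e).
have es : surj e.
  move=> k; have /(tr_q_exact (tr X))[f fk] : syz_p (trsyz X) (syz_i (trsyz X) k) = 0.
    exact: (exact0 _ (syz_exact (trsyz X))).
  by exists f; apply: (syz_inj (trsyz X)); rewrite eP.
exists (@TrData X (FPMod (free_fp B n)) d e (@free_projective B n) es dP eP).
by [].
Qed.

Section One.
Variables (X : stmod A) (D : trdata X).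

Definition td_tr : transpose t' (syz_K (trsyz X) : stmod B) :=
  @coker_transpose B A t' (syz_K (trsyz X)) (td_Q D) (dualP0 X) (td_d D) (td_e D)
    (td_proj D) (dual_projective t (tr_proj0 (tr X))) (td_surj D) (td_exact D).

Lemma td_d0 y x : (td_d D y : dual t _) (tr_d (tr X) x) = 0.
Proof.
have e0 : td_e D (td_d D y) = 0 by apply: (exact0 _ (td_exact D)).
have := td_eE D (td_d D y); rewrite e0 linear0 => /esym d0.
by rewrite -dual_mapE d0.
Qed.

Lemma td_j_ex : exists j : {linear X -> dual t' (td_Q D)}, forall x y,
  j (tr_e (tr X) x) y = to_op t ((td_d D y : dual t _) x).
Proof.
have [|j jP] := lin_factor
    (g := dual_map t' (td_d D : {linear _ -> dual t _}) \o @eval _ _ t _)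
    (tr_e_surj (tr X)); last by exists j => x y; rewrite jP.
move=> x /(tr_e_exact (tr X))[z <-]; apply: dual_eq => y.
by rewrite /= td_d0 to_op0.
Qed.

Definition td_j := projT1 (cid td_j_ex).

Lemma td_jE x y : td_j (tr_e (tr X) x) y = to_op t ((td_d D y : dual t _) x).
Proof. exact: (projT2 (cid td_j_ex)). Qed.

Lemma td_j_exact : exact_at td_j (tr_q td_tr).
Proof.
move=> g; split=> [/(tr_q_exact td_tr)[F <-]|[x <-]].
  have [|x xP] := dual_reflexive (F : {linear dual t (tr_P0 (tr X)) -> B^o}).
    by apply: projective_retract (tr_proj0 _); apply: fp_fg; apply: fpP.
  by exists (tr_e (tr X) x); apply: dual_eq => y; rewrite td_jE dual_mapE -xP.
have [z <-] := tr_e_surj (tr X) x; apply/(tr_q_exact td_tr).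
by exists (eval t _ z); apply: dual_eq => y; rewrite td_jE.
Qed.

Lemma td_approx1 (g : {linear X -> A^o}) :
  exists h : {linear dual t' (td_Q D) -> A^o}, forall x, h (td_j x) = g x.
Proof.
pose f : dual t (tr_P0 (tr X)) := g \o tr_e (tr X).
have /(td_exact D)[y yf] : td_e D f = 0.
  apply: (syz_inj (trsyz X)); rewrite td_eE linear0; apply: dual_eq => x.
  by rewrite dual_mapE /= (exact0 _ (tr_e_exact _)) linear0.
have hl : linear (fun k : dual t' (td_Q D) => of_op t (k y) : A^o).
  by move=> b k l; rewrite dualDE dualZE of_opD of_opM to_opK.
exists (lin hl) => x; have [z <-] := tr_e_surj (tr X) x.
by rewrite /= td_jE to_opK yf.
Qed.

Lemma td_approx (P : fpmod A) (g : {linear X -> P}) : projective P ->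
  exists h : {linear dual t' (td_Q D) -> P}, forall x, h (td_j x) = g x.
Proof.
move=> /(projective_retract (fp_fg (fpP P)))[n [s [r sK]]].
have gl i : linear (fun x => s (g x) 0 i : A^o) by move=> a x y; rewrite !linearP !mxE.
have /choice[h hP] i := td_approx1 (lin (gl i)).
have hl : linear (fun k => \row_i h i k).
  by move=> a x y; apply/rowP => i; rewrite !mxE linearP.
exists (r \o lin hl) => x /=; rewrite -[RHS]sK; congr (r _); apply/rowP => i.
by rewrite mxE hP.
Qed.

Definition td_cs : cosyzygy X :=
  @Cosyzygy A X (FPMod (dual_fp t' (td_proj D))) (tr_T td_tr) td_j (tr_q td_tr)
    (dual_projective t' (td_proj D)) (tr_q_surj td_tr) td_j_exact td_approx.

End One.

Lemma td_cs_map X X' (D : trdata X) (D' : trdata X') (f : {linear X -> X'}) tf :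
  transpose_map (tr X) (tr X') f tf ->
  exists k r, [/\ syzygy_map (trsyz X') (trsyz X) tf k,
    transpose_map (td_tr D') (td_tr D) k r &
    @cosyzygy_map A X X' (td_cs D) (td_cs D') f r].
Proof.
move=> [f0 [f1 [f0P f1P tfP]]].
have [|k kP] := @lin_lift _ _ _ _ (syz_i (trsyz X))
    (dual_map t f1 \o syz_i (trsyz X')) (syz_inj (trsyz X)).
  move=> x; apply/(syz_exact (trsyz X)) => /=; rewrite -tfP.
  by rewrite [tr_q _ _](exact0 x (syz_exact (trsyz X'))) linear0.
have ek h : td_e D (dual_map t f0 h) = k (td_e D' h).
  apply: (syz_inj (trsyz X)); rewrite kP td_eE.
  transitivity (dual_map t f1 (dual_map t (tr_d (tr X')) h)); last first.
    by rewrite -(td_eE D').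
  by apply: dual_eq => x; rewrite !dual_mapE f1P.
have [|w wP] := projective_lift_exact (h := dual_map t f0 \o td_d D') (td_proj D')
    (td_exact D).
  by move=> x; rewrite /= ek (exact0 _ (td_exact D')) linear0.
have [|r rP] := lin_factor (g := tr_q (td_tr D') \o dual_map t' w) (tr_q_surj (td_tr D)).
  move=> h /(tr_q_exact (td_tr D))[F <-] /=; apply/(tr_q_exact (td_tr D')).
  exists (dual_map t' (dual_map t f0) F); apply: dual_eq => y.
  by rewrite !dual_mapE wP.
exists k, r; split.
- by exists (dual_map t f1); split=> x; rewrite ?tfP ?kP.
- by exists (dual_map t f0), w; split=> // h; rewrite rP.
- exists (dual_map t' w); split=> [x|y]; last by rewrite rP.
  have [z <-] := tr_e_surj (tr X) x; rewrite -f0P; apply: dual_eq => y.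
  by rewrite dual_mapE !td_jE wP.
Qed.

End SigmaCosyzygy.

Section AuslanderReiten.
Variables (A B : pzRingType) (t : opposite A B).
Variables (noethA : left_noetherian A) (noethB : left_noetherian B).
Local Notation t' := (opposite_sym t).
Implicit Types X Y : stmod A.
Local Notation tr := (a_transpose t).
Local Notation tr' := (a_transpose t').
Local Notation Om := (Omega noethA).
Local Notation Si := (Sigma t noethB).

Definition a_trdata X : trdata t noethB X := projT1 (cid (trdata_ex t noethB X)).
Local Notation D := a_trdata.
Local Notation sy X := (a_syzygy noethB (tr_T (tr X))).
Local Notation cs X := (td_cs (D X)).

(* Sigma X and the cosyzygy [cs X] are transposes of two syzygies of Tr X. *)
Record comparison X := Comparison {
  cmp_g1 : {linear syz_K (trsyz t noethB X) -> syz_K (sy X)};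
  cmp_g2 : {linear syz_K (sy X) -> syz_K (trsyz t noethB X)};
  cmp_a : {linear tr_T (tr' (syz_K (sy X))) -> cs_C (cs X)};
  cmp_b : {linear cs_C (cs X) -> tr_T (tr' (syz_K (sy X)))};
  cmp_g1P : syzygy_map (trsyz t noethB X) (sy X) idfun cmp_g1;
  cmp_g2P : syzygy_map (sy X) (trsyz t noethB X) idfun cmp_g2;
  cmp_aP : transpose_map (td_tr (D X)) (tr' (syz_K (sy X))) cmp_g1 cmp_a;
  cmp_bP : transpose_map (tr' (syz_K (sy X))) (td_tr (D X)) cmp_g2 cmp_b
}.

Lemma comparison_ex X : exists c : comparison X, True.
Proof.
have [g1 g1P] := syzygy_map_ex (trsyz t noethB X) (sy X) idfun.
have [g2 g2P] := syzygy_map_ex (sy X) (trsyz t noethB X) idfun.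
have [a aP] := transpose_map_ex (td_tr (D X)) (tr' (syz_K (sy X))) g1.
have [b bP] := transpose_map_ex (tr' (syz_K (sy X))) (td_tr (D X)) g2.
by exists (Comparison g1P g2P aP bP).
Qed.

Definition cmp X := projT1 (cid (comparison_ex X)).
Definition ca X : @hom (stmod A) (Si X) (cs_C (cs X)) := cmp_a (cmp X).
Definition cb X : @hom (stmod A) (cs_C (cs X)) (Si X) := cmp_b (cmp X).

Lemma caK X : cb X \\o ca X ~= idm (Si X).
Proof.
apply: transpose_map_eq (transpose_map_comp (cmp_aP _) (cmp_bP _)) (transpose_map_id _).
apply: syzygy_map_eq (syzygy_map_comp (cmp_g1P _) (cmp_g2P _)) (syzygy_map_id _).
exact: stable_eq1.
Qed.

Lemma cbK X : ca X \\o cb X ~= idm _.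
Proof.
apply: transpose_map_eq (transpose_map_comp (cmp_bP _) (cmp_aP _)) (transpose_map_id _).
apply: syzygy_map_eq (syzygy_map_comp (cmp_g2P _) (cmp_g1P _)) (syzygy_map_id _).
exact: stable_eq1.
Qed.

Lemma ca_nat X X' (f : hom X X') : exists r : @hom (stmod A) (cs_C (cs X)) (cs_C (cs X')),
  cosyzygy_map f r /\ r \\o ca X ~= ca X' \\o fmap Si f.
Proof.
have [k [r [kP rP fr]]] := td_cs_map (D X) (D X') (Tr_mapP t f).
exists r; split=> //.
apply: transpose_map_eq (transpose_map_comp (cmp_aP _) rP)
  (transpose_map_comp (Tr_mapP t' _) (cmp_aP _)).
apply: syzygy_map_eq (syzygy_map_comp (cmp_g1P _) kP)
  (syzygy_map_comp (Omega_mapP noethB _) (cmp_g1P _)).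
exact: stable_eq1.
Qed.

Lemma cb_nat X X' (f : hom X X') : exists r : @hom (stmod A) (cs_C (cs X)) (cs_C (cs X')),
  [/\ cosyzygy_map f r, r \\o ca X ~= ca X' \\o fmap Si f &
    fmap Si f \\o cb X ~= cb X' \\o r].
Proof.
have [r [fr rP]] := ca_nat f; exists r; split=> //.
rewrite -[r in X in _ ~= X]hcompm1 -(cbK X) (hcompA r) rP !hcompA caK.
by rewrite hcomp1m.
Qed.

Lemma unit_ex X : exists u : @hom (stmod A) X (Om (Si X)),
  adjoint_map (cs X) (a_syzygy noethA (Si X)) (cb X) u.
Proof. exact: adjoint_map_exr. Qed.

Lemma counit_ex Y : exists g : @hom (stmod A) (cs_C (cs (Om Y))) Y,
  adjoint_map (cs (Om Y)) (a_syzygy noethA Y) g (idm (Om Y)).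
Proof. exact: adjoint_map_exl. Qed.

Definition ar_unit X := projT1 (cid (unit_ex X)).
Definition ar_g Y := projT1 (cid (counit_ex Y)).

Lemma ar_unitP X :
  adjoint_map (cs X) (a_syzygy noethA (Si X)) (cb X) (ar_unit X).
Proof. exact: (projT2 (cid (unit_ex X))). Qed.

Lemma ar_gP Y :
  adjoint_map (cs (Om Y)) (a_syzygy noethA Y) (ar_g Y) (idm (Om Y)).
Proof. exact: (projT2 (cid (counit_ex Y))). Qed.

(* Auslander-Reiten: Sigma is left adjoint to Omega. *)
Definition Sigma_Omega_adj : adjunction Si Om.
Proof.
refine (@Adjunction _ _ Si Om ar_unit (fun Y => ar_g Y \\o ca (Om Y)) _ _ _ _).
- move=> X X' f; have [r [fr _ rP]] := cb_nat f.
  exact: adjoint_map_eqr rP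
    (adjoint_map_compl (ar_unitP X) (Omega_mapP noethA (fmap Si f)))
    (adjoint_map_compr (ar_unitP X') fr).
- move=> Y Y' h; have [r [fr rP _]] := cb_nat (fmap Om h).
  rewrite -(hcompA (ar_g Y')) -rP !hcompA.
  suff -> : h \\o ar_g Y ~= ar_g Y' \\o r by [].
  apply: adjoint_map_eql (adjoint_map_compl (ar_gP Y) (Omega_mapP noethA h))
    (adjoint_map_compr (ar_gP Y') fr).
  exact: stable_eq1.
- move=> X; have [r [fr rP _]] := cb_nat (ar_unit X).
  rewrite -(hcompA (ar_g _)) -rP hcompA.
  suff -> : ar_g (Si X) \\o r ~= cb X by rewrite caK.
  apply: adjoint_map_eql (adjoint_map_compr (ar_gP _) fr) (ar_unitP X).
  exact: stable_eq1.
- move=> Y.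
  apply: adjoint_map_eqr (adjoint_map_compl (ar_unitP (Om Y)) (Omega_mapP noethA _)) (ar_gP Y).
  rewrite -[stable_eq _ _]/(((ar_g Y \\o ca (Om Y)) \\o cb (Om Y)) ~= ar_g Y).
  by rewrite -hcompA cbK hcompm1.
Defined.

End AuslanderReiten.

Section Iterates.
Variables (C : category) (F G : functor C C).

Fixpoint powF n : functor C C :=
  if n is m.+1 then compF G (powF m) else idF C.

(* F^(n+1) = F^n F, whereas G^(n+1) = G G^n: the order in which the adjunction
   below composes. *)
Fixpoint powFl n : functor C C :=
  if n is m.+1 then compF (powFl m) F else idF C.

Variable a : adjunction F G.

Fixpoint pow_adj n : adjunction (powFl n) (powF n) :=
  if n is m.+1 then comp_adj a (pow_adj m) else id_adj C.

End Iterates.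

Definition retract (C : category) (X Y : C) :=
  exists (s : hom X Y) (r : hom Y X), r \\o s ~= idm X.

Definition split_mono (C : category) (X Y : C) (f : hom X Y) :=
  exists r : hom Y X, r \\o f ~= idm X.

(* [option nat] stands for nat with infinity adjoined, [None] being infinity. *)
Definition enat_le (x y : option nat) : Prop :=
  match x, y with
  | _, None => True
  | Some m, Some n => (m <= n)%N
  | None, Some _ => False
  end.

Definition enat_inf (E : set nat) : option nat :=
  match pselect (exists n, `[< E n >]) with
  | left ex => Some (ex_minn ex)
  | right _ => None
  end.

Definition enat_sup (E : set (option nat)) : option nat :=
  enat_inf [set n | forall x, E x -> enat_le x (Some n)].

Section Delooping.
Variables (L : pzRingType) (noethL : noetherian L).

Definition rmod := stmod L^c.

Definition conv_opposite : opposite L^c L :=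
  @Opposite L^c L id id (fun _ => erefl) (fun _ => erefl) (fun _ _ => erefl)
    erefl (fun _ _ => erefl).

Definition Omegan : nat -> functor rmod rmod := powF (Omega noethL.2).

Definition Sigman : nat -> functor rmod rmod := powFl (Sigma conv_opposite noethL.1).

Definition unit_eta n (X : rmod) : hom X (Omegan n (Sigman n X)) :=
  adj_unit (pow_adj (Sigma_Omega_adj conv_opposite noethL.2 noethL.1) n) X.

Definition dell (M : rmod) : option nat :=
  enat_inf [set n | exists N : rmod, retract (Omegan n M) (Omegan n.+1 N)].

Definition dell_ring : option nat :=
  enat_sup [set d | exists2 S : fpmod L^c, simple_module S & d = dell S].

End Delooping.

(* Main.v *)
(** Any section [s : X -> G Y] into the image of a right adjoint [G] factors as
    [G s' \o eta_X], so [X] is a retract of some [G Y] iff the unit [eta_X]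
    splits. Applied to [Sigma^(n+1) -| Omega^(n+1)] and [X = Omega^n S], this
    reduces the theorem to the remark that [dell S <= n] holds iff [Omega^n S] is
    a stable retract of some [Omega^(n+1) N]: the infimum may be attained at an
    earlier stage [m <= n], but [Omega^(n-m)] preserves retracts. *)
Require Import Defs.
From HB Require Import structures.
From mathcomp Require Import all_boot all_algebra.
From mathcomp Require Import boolp classical_sets.

Set Implicit Arguments.
Unset Strict Implicit.
Unset Printing Implicit Defensive.

Lemma retract_fmap (C D : category) (F : functor C D) (X Y : C) :
  retract X Y -> retract (F X) (F Y).
Proof.
move=> [s [r rs]]; exists (fmap F s), (fmap F r).
by rewrite -fmap_comp rs fmap_id.
Qed.

Lemma retract_powF_add (C : category) (F : functor C C) (X Y : C) (k m n : nat) :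
  retract (powF F m X) (powF F n Y) ->
  retract (powF F (k + m) X) (powF F (k + n) Y).
Proof. by move=> rXY; elim: k => // k; exact: (@retract_fmap _ _ F). Qed.

Lemma retract_right_adjoint_tfae (C D : category) (F : functor C D)
    (G : functor D C) (a : adjunction F G) (X : C) :
  [<-> exists Y : D, retract X (G Y);
       retract X (G (F X));
       split_mono (adj_unit a X)].
Proof.
have split_unit Y : retract X (G Y) -> split_mono (adj_unit a X).
  move=> [s [r rs]]; exists (r \\o fmap G (adj_counit a Y \\o fmap F s)).
  by rewrite fmap_comp -!hcompA unit_nat (hcompA (fmap G _)) counit_unit hcomp1m.
tfae.
- by move=> [Y /split_unit[r rK]]; exists (adj_unit a X), r.
- exact: split_unit.
- by move=> [r rK]; exists (F X), (adj_unit a X), r.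
Qed.

Lemma enat_inf_leP (E : set nat) (n : nat) :
  enat_le (enat_inf E) (Some n) <-> exists2 m, (m <= n)%N & E m.
Proof.
rewrite /enat_inf; case: pselect => [ex|nex] /=.
  case: ex_minnP => m /asboolP Em min_m; split=> [le_mn|[k le_kn Ek]].
    by exists m.
  exact: leq_trans (min_m k (asboolT Ek)) le_kn.
by split=> // -[m _ Em]; case: nex; exists m; apply: asboolT.
Qed.

Lemma enat_sup_leP (E : set (option nat)) (n : nat) :
  enat_le (enat_sup E) (Some n) <-> forall x, E x -> enat_le x (Some n).
Proof.
split=> [/enat_inf_leP[m le_mn Em] x /Em|En]; last by apply/enat_inf_leP; exists n.
by case: x => //= k le_km; apply: leq_trans le_mn.
Qed.

Section DeloopingLevel.
Variables (L : pzRingType) (noethL : noetherian L).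

Lemma dell_leP (M : rmod L) (n : nat) : enat_le (dell noethL M) (Some n) <->
  exists N : rmod L, retract (Omegan noethL n M) (Omegan noethL n.+1 N).
Proof.
split=> [/enat_inf_leP[m le_mn [N rMN]]|rM]; last by apply/enat_inf_leP; exists n.
by exists N; rewrite -(subnK le_mn) -addnS; apply: retract_powF_add.
Qed.

Lemma dell_ring_leP (n : nat) : enat_le (dell_ring noethL) (Some n) <->
  forall S : fpmod L^c, simple_module S -> enat_le (dell noethL S) (Some n).
Proof.
split=> [/enat_sup_leP dn S simS|dn]; first by apply: dn; exists S.
by apply/enat_sup_leP => _ [S simS ->]; apply: dn.
Qed.

End DeloopingLevel.

Theorem corollary1p12 (L : pzRingType) (noethL : noetherian L)
    (semiperfectL : semiperfect L) (n : nat) :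
  [<-> (* (i) *)   enat_le (dell_ring noethL) (Some n);
       (* (ii) *)  forall S : fpmod L^c, simple_module S ->
                     retract (Omegan noethL n S)
                       (Omegan noethL n.+1
                         (Sigman noethL n.+1 (Omegan noethL n S)));
       (* (iii) *) forall S : fpmod L^c, simple_module S ->
                     split_mono (unit_eta noethL n.+1 (Omegan noethL n S))].
Proof.
pose adj := pow_adj (Sigma_Omega_adj (conv_opposite L) noethL.2 noethL.1) n.+1.
have unit_tfae (S : fpmod L^c) :=
  retract_right_adjoint_tfae adj (Omegan noethL n S).
tfae.
- by move=> /dell_ring_leP dn S /dn/dell_leP/(unit_tfae S 0 1).
- by move=> rS S /rS/(unit_tfae S 1 2).
- move=> splitS; apply/dell_ring_leP => S /splitS/(unit_tfae S 2 0) rS.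
  exact/dell_leP.
Qed.
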